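(* Let $(\mathcal{M},d,\tilde{\mathcal{M}},\mathfrak{g})$ be a $k$-dimensional body manifold. For every $p\in(1,\infty)$, the energy density $$W_{(\mathcal{M},\mathfrak{g})}(du)=(\operatorname{Dis}du)^p$$ is $p$-regular, where $u$ is considered as a map $(\mathcal{M},d,\tilde{\mathcal{M}},\mathfrak{g})\to(\mathbb{R}^k,\mathfrak{e})$.
   Context: Linear algebra. $\mathfrak{e}$ is the Euclidean metric on $\mathbb{R}^k$. For oriented $k$-dimensional inner-product spaces $(V,\mathfrak{g})$, $(V',\mathfrak{h})$ and a linear map $A:V\to V'$, the Frobenius norm is $(\operatorname{tr}A^TA)^{1/2}$; $|A|$ is written when the choice between the Frobenius norm and the operator norm is irrelevant. $\mathrm{SO}(\mathfrak{g},\mathfrak{h})$ is the set of orientation- and inner-product-preserving isomorphisms $V\to V'$, and $\operatorname{Dis}A$ is the Frobenius distance from $A$ to $\mathrm{SO}(\mathfrak{g},\mathfrak{h})$. Thus the energy density of the claim assigns to $A\in T_x^*\tilde{\mathcal{M}}\otimes\mathbb{R}^k$, viewed as a linear map $(T_x\tilde{\mathcal{M}},\mathfrak{g}_x)\to(\mathbb{R}^k,\mathfrak{e})$, the $p$-th power of its Frobenius distance to $\mathrm{SO}(\mathfrak{g}_x,\mathfrak{e})$. Body manifolds. A body manifold is a quadruple $(\mathcal{M},d,\tilde{\mathcal{M}},\mathfrak{g})$ where $\mathcal{M}$ is a $k$-dimensional compact, oriented, connected topological manifold with corners; $d$ is a distance function on $\mathcal{M}$; $\tilde{\mathcal{M}}\subset\mathcal{M}$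 is an open smooth submanifold such that $\mathcal{M}\setminus\tilde{\mathcal{M}}$ has zero $k$-dimensional Hausdorff measure with respect to $d$; and $\mathfrak{g}$ is a Riemannian metric on $\tilde{\mathcal{M}}$ such that for all $x,y\in\mathcal{M}$, $d(x,y)$ is the infimum of the lengths $\int_I\sqrt{\mathfrak{g}(\dot\gamma,\dot\gamma)}\,dt$ over continuous paths $\gamma:I\to\mathcal{M}$ from $x$ to $y$ that are a.e. smooth (in particular $\gamma(t)\in\tilde{\mathcal{M}}$ for a.e. $t$). $p$-regularity. Let $\mathfrak{M}$ be a class of body manifolds. An energy density on $\mathfrak{M}$ is a function $W:\bigsqcup_{(\mathcal{M},d,\tilde{\mathcal{M}},\mathfrak{g})\in\mathfrak{M}}T^*\tilde{\mathcal{M}}\otimes\mathbb{R}^k\to\mathbb{R}$; $W_{(\mathcal{M},\mathfrak{g})}$ is its restriction to one manifold. It is $p$-regular, $p\in(1,\infty)$, if: (a) each $W_{(\mathcal{M},\mathfrak{g})}$ is a Carathéodory function (measurable in the base point, continuous on fibers); (b) there are $\alpha,\beta>0$ such that for every manifold in $\mathfrak{M}$, $W_{(\mathcal{M},\mathfrak{g})}(A)\ge\alpha|A|^p-\beta$ for all $A\in T^*\tilde{\mathcal{M}}\otimes\mathbb{R}^k$; (c) there is $\gamma>0$ such that for every manifold in $\mathfrak{M}$, $W_{(\mathcal{M},\mathfrak{g})}(A)\le\gamma(|A|^p+1)$ for all such $A$; (d) there is $C>0$ such that for all $(\mathcal{M},d,\tilde{\mathcal{M}},\mathfrak{g}),(\mathcal{N},d',\tilde{\mathcal{N}},\mathfrak{h})\in\mathfrak{M}$,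 linear isomorphisms $L:T_x\tilde{\mathcal{M}}\to T_y\tilde{\mathcal{N}}$ ($x\in\tilde{\mathcal{M}}$, $y\in\tilde{\mathcal{N}}$) and $A\in T_y^*\tilde{\mathcal{N}}\otimes\mathbb{R}^k$, $$|W_{(\mathcal{M},\mathfrak{g})}(A\circ L)^{1/p}-W_{(\mathcal{N},\mathfrak{h})}(A)^{1/p}|\le C(1+|A|)\operatorname{Dis}L.$$ The formula in the claim is to be read as prescribing the energy density on each $k$-dimensional body manifold under consideration. *)

(* Defs.v *)
From HB Require Import structures.
From mathcomp Require Import all_boot all_order all_algebra.
From mathcomp Require Import all_classical all_reals all_analysis.
Set Implicit Arguments.
Unset Strict Implicit.
Unset Printing Implicit Defensive.
Import Order.TTheory GRing.Theory Num.Theory numFieldNormedType.Exports.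
Local Open Scope classical_set_scope.
Local Open Scope ring_scope.

Section oriented_inner_product_spaces.
Context {R : realType} {k : nat}.

(* An inner product on V is a function V -> V -> R, an orientation of a
   k-dimensional V is given by the set of its positively oriented bases. *)

Definition inner_product (V : vectType R) (g : V -> V -> R) : Prop :=
  [/\ forall a u v w, g (a *: u + v) w = a * g u w + g v w,
      forall u v, g u v = g v u &
      forall u, u != 0 -> 0 < g u u].

Definition lfun_trace (V : vectType R) (f : 'End(V)) : R :=
  \tr (passmx.mxof (vbasis {:V}) (vbasis {:V}) f).

Definition adjoint (V W : vectType R) (g : V -> V -> R) (h : W -> W -> R)
    (A : 'Hom(V, W)) : 'Hom(W, V) :=
  xget 0 [set B : 'Hom(W, V) | forall v w, g (B w) v = h w (A v)].

Definition frobenius (V W : vectType R) (g : V -> V -> R) (h : W -> W -> R)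
    (A : 'Hom(V, W)) : R :=
  Num.sqrt (lfun_trace (adjoint g h A \o A)%VF).

Definition SO (V W : vectType R) (g : V -> V -> R) (o : set (k.-tuple V))
    (h : W -> W -> R) (o' : set (k.-tuple W)) : set 'Hom(V, W) :=
  [set Q | [/\ bijective Q,
               forall u v, h (Q u) (Q v) = g u v &
               forall e, o e -> o' (map_tuple Q e)]].

Definition Dis (V W : vectType R) (g : V -> V -> R) (o : set (k.-tuple V))
    (h : W -> W -> R) (o' : set (k.-tuple W)) (A : 'Hom(V, W)) : R :=
  inf [set frobenius g h (A - Q) | Q in SO g o h o'].

Definition euclidean (u v : 'rV[R]_k) : R := (u *m v^T) 0 0.

Definition standard_orientation : set (k.-tuple 'rV[R]_k) :=
  [set e | 0 < \det (\matrix_(i < k) tnth e i)].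

End oriented_inner_product_spaces.

Section smooth_maps.
Context {R : realType}.

Fixpoint Cn (V W : normedModType R) (n : nat) (U : set V) (f : V -> W) : Prop :=
  if n is m.+1 then
    (forall x, U x -> differentiable f x) /\ (forall v, Cn m U ('D_v f))
  else forall x, U x -> {for x, continuous f}.

(* Meant for open U. *)
Definition smooth (V W : normedModType R) (U : set V) (f : V -> W) : Prop :=
  forall n, Cn n U f.

Definition smooth_within (V W : normedModType R) (S : set V) (f : V -> W) :=
  forall y, S y -> exists U (F : V -> W),
    [/\ open U, U y, smooth U F & forall z, U z -> S z -> F z = f z].

(* J is the Jacobian at y of f : S -> R^n; row vectors, so that the
   differential is v |-> v *m J.  See jacobian_within_uniq. *)
Definition jacobian_within m n (S : set 'rV[R]_m) (f : 'rV[R]_m -> 'rV[R]_n)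
    (y : 'rV[R]_m) (J : 'M[R]_(m, n)) : Prop :=
  exists F : 'rV[R]_m -> 'rV[R]_n,
    [/\ differentiable F y, (\forall z \near y, S z -> F z = f z) & 'J F y = J].

End smooth_maps.

Section charts.
Context {R : realType} {k : nat}.

(* The local model of a manifold with corners is the closed cube rather than
   [0, +oo[^k.  Both have the same germs, but the reflection t |-> 1 - t of the
   cube lets manifolds such as [0, 1] have an atlas of oriented charts. *)
Definition cube : set 'rV[R]_k := [set y | forall i, 0 <= y 0 i <= 1].

Record chart (M : topologicalType) := Chart {
  chart_dom : set M;
  chart_fun :> M -> 'rV[R]_k;
  chart_inv : 'rV[R]_k -> M;
  chart_open : open chart_dom;
  chart_cont : {within chart_dom, continuous chart_fun};
  chart_img : exists2 O, open O & chart_fun @` chart_dom = O `&` cube;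
  chartK : forall x, chart_dom x -> chart_inv (chart_fun x) = x;
  chart_inv_cont : {within chart_fun @` chart_dom, continuous chart_inv} }.

Definition overlap (M : topologicalType) (c c' : chart M) : set 'rV[R]_k :=
  c @` (chart_dom c `&` chart_dom c').

Definition transition (M : topologicalType) (c c' : chart M) :
    'rV[R]_k -> 'rV[R]_k :=
  c' \o chart_inv c.

(* The Brouwer degree of the injective continuous map f at y is 1.  The degree
   is computed, on a closed ball around y, by a smooth g which is homotopic to f
   through maps whose restriction to the sphere avoids f y, and which has f y as
   a regular value. *)
Definition degree1_at (S : set 'rV[R]_k) (f : 'rV[R]_k -> 'rV[R]_k)
    (y : 'rV[R]_k) : Prop :=
  exists (r : R) (g : 'rV[R]_k -> 'rV[R]_k),
    [/\ 0 < r /\ [set z | `|z - y| <= r] `<=` S,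
        smooth setT g,
        forall z, `|z - y| = r -> `|g z - f z| < `|f z - f y|,
        forall z, `|z - y| <= r -> g z = f y -> \det ('J g z) != 0 &
        \sum_(z \in [set z | `|z - y| <= r /\ g z = f y])
          Num.sg (\det ('J g z)) = 1].

Definition same_orientation (M : topologicalType) (c c' : chart M) : Prop :=
  forall y, (overlap c c')° y -> degree1_at (overlap c c') (transition c c') y.

Definition oriented_topological_atlas (M : topologicalType)
    (A : set (chart M)) : Prop :=
  \bigcup_(c in A) chart_dom c = setT /\
  (forall c c', A c -> A c' -> same_orientation c c').

Record smooth_submanifold (M : topologicalType) := SmoothSubmanifold {
  sm_set : set M;
  sm_atlas : set (chart M);
  sm_cover : \bigcup_(c in sm_atlas) chart_dom c = sm_set;
  sm_smooth : forall c c', sm_atlas c -> sm_atlas c' ->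
    smooth_within (overlap c c') (transition c c');
  sm_oriented : forall c c' y J, sm_atlas c -> sm_atlas c' ->
    overlap c c' y -> jacobian_within (overlap c c') (transition c c') y J ->
    0 < \det J }.

Lemma jacobian_within_uniq (S : set 'rV[R]_k) (f : 'rV[R]_k -> 'rV[R]_k) y J J' :
  cube y -> (\forall z \near y, cube z -> S z) ->
  jacobian_within S f y J -> jacobian_within S f y J' -> J = J'.
Proof.
move=> cy Sy [F [dF Ff <-]] [G [dG Gf <-]].
apply/row_matrixP => i.
have rowJ (H : 'rV[R]_k -> 'rV[R]_k) : differentiable H y ->
    row i ('J H y) = 'D_(delta_mx 0 i) H y.
  move=> dH; rewrite (deriveEjacobian _ dH).
  by move: ('J H y) => A; exact: rowE.
apply: (etrans (rowJ F dF)); apply: (etrans _ (esym (rowJ G dG))).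
pose s : R := if y 0 i < 1 then 1 else -1.
have hs : forall t : R, 0 < t -> t <= 2^-1 ->
    (y 0 i < 1 -> t < 1 - y 0 i) -> cube (y + (t * s) *: delta_mx 0 i).
  move=> t t0 t2 ty j; rewrite !mxE eqxx/=.
  case: eqVneq => [->|_]; last by rewrite mulr0 addr0; exact: cy.
  move: (cy i) => /andP[y0 y1]; rewrite mulr1 /s; case: ifPn => yi.
    rewrite mulr1 addr_ge0 ?(ltW t0)//=.
    by rewrite addrC -lerBrDr ltW// ty.
  have -> : y 0 i = 1 by apply/eqP; rewrite eq_le y1 leNgt.
  rewrite mulrN1 gerBl (ltW t0) andbT subr_ge0 (le_trans t2)//.
  by rewrite invf_le1 ?ltr0n// ler1n.
set v := delta_mx 0 i.
have sE : s = 1 \/ s = -1 by rewrite /s; case: ifP => _; [left|right].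
have s0 : s != 0 by case: sE => ->; rewrite ?oppr_eq0 oner_eq0.
have DZ (H : 'rV[R]_k -> 'rV[R]_k) : differentiable H y ->
    'D_(s *: v) H y = s *: 'D_v H y.
  move=> dH; apply: (etrans (deriveE _ dH)).
  rewrite linearZ; congr (_ *: _); apply/esym; exact: deriveE.
suff E : 'D_(s *: v) F y = 'D_(s *: v) G y.
  apply: (scalerI s0).
  exact: (etrans (esym (DZ F dF)) (etrans E (DZ G dG))).
have cvgH (H : 'rV[R]_k -> 'rV[R]_k) : differentiable H y ->
    (fun h : R => h^-1 *: ((H \o shift y) (h *: (s *: v)) - H y)) h @[h --> 0^'+]
      --> 'D_(s *: v) H y.
  by move=> dH; apply: cvg_dnbhs_at_right; exact: (diff_derivable dH).
have Sy' : \forall z \near y, cube z -> F z = G z.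
  near=> z => cz.
  have Sz : S z by move: cz; near: z.
  have -> : F z = f z by move: Sz; near: z.
  by apply/esym; move: Sz; near: z.
have FGy : F y = G y by exact: (nbhs_singleton Sy').
apply: (cvg_unique _ (cvgH F dF)) => //.
have lineC : (fun h : R => h *: (s *: v) + y) @ 0 --> y.
  rewrite -[X in _ --> X]add0r -(scale0r (s *: v)).
  by apply: cvgD; [exact: cvgZl | exact: cvg_cst].
have ty : \forall t \near 0^'+, y 0 i < 1 -> t < 1 - y 0 i.
  case: (ltP (y 0 i) 1) => yi; last by near=> u.
  by near=> u => _; near: u; apply: nbhs_right_lt; rewrite subr_gt0.
apply: cvg_trans (cvgH G dG).
apply: near_eq_cvg; near=> t.
have t0 : 0 < t by near: t; exact: nbhs_right_gt.
rewrite /= FGy; congr (_ *: (_ - _)).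
have ct : cube (t *: (s *: v) + y).
  rewrite scalerA addrC; apply: hs => //; first by near: t; exact: nbhs_right_le.
  by near: t.
move: ct; near: t.
have := cvg_at_right_filter lineC Sy'.
by rewrite nbhs_simpl /=; apply: filterS => u /= FG /FG ->.
Unshelve. all: by end_near. Qed.


Lemma overlap_near (M : topologicalType) (c c' : chart M) y :
  overlap c c' y -> \forall z \near y, cube z -> overlap c c' z.
Proof.
move=> -[x [cx c'x] <-]; have [U oU imgU] := @chart_img _ c.
have cimg : (c @` chart_dom c) (c x) by exists x.
have Ux : U (c x) by move: cimg; rewrite imgU => -[].
move: (@chart_inv_cont _ c) => /subspace_continuousP/(_ _ cimg).
rewrite /from_subspace chartK// => /(_ (chart_dom c')) c'V.
have {}c'V : \forall z \near c x, (c @` chart_dom c) z -> chart_dom c' (chart_inv c z).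
  by apply: c'V; apply: open_nbhs_nbhs; split => //; exact: chart_open.
near=> z => cz.
have [x' cx' xz] : (c @` chart_dom c) z.
  by rewrite imgU; split => //; near: z; exact: open_nbhs_nbhs.
exists x' => //; split => //; rewrite -(chartK cx') xz.
suff : (c @` chart_dom c) z -> chart_dom c' (chart_inv c z) by apply; exists x'.
by near: z.
Unshelve. all: by end_near. Qed.

Lemma overlap_cube (M : topologicalType) (c c' : chart M) :
  overlap c c' `<=` cube.
Proof.
move=> _ [x [cx _] <-]; have [U _ imgU] := @chart_img _ c.
have : (c @` chart_dom c) (c x) by exists x.
by rewrite imgU => -[].
Qed.

Lemma jacobian_transition_uniq (M : topologicalType) (c c' : chart M) y J J' :
  overlap c c' y ->
  jacobian_within (overlap c c') (transition c c') y J ->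
  jacobian_within (overlap c c') (transition c c') y J' -> J = J'.
Proof.
move=> cy; apply: jacobian_within_uniq; first exact: overlap_cube cy.
exact: overlap_near.
Qed.

Lemma jacobian_transition_comp (M : topologicalType) (c0 c c' : chart M) x J J' :
  chart_dom c0 x -> chart_dom c x -> chart_dom c' x ->
  jacobian_within (overlap c0 c) (transition c0 c) (c0 x) J ->
  jacobian_within (overlap c c') (transition c c') (c x) J' ->
  jacobian_within (overlap c0 c') (transition c0 c') (c0 x) (J *m J').
Proof.
move=> c0x cx c'x [F [dF Fe JF]] [G [dG Ge JG]].
have Fx : F (c0 x) = c x.
  rewrite (nbhs_singleton Fe); last by exists x.
  by rewrite /transition /= chartK.
rewrite -Fx in dG Ge JG.
exists (G \o F); split; first exact: differentiable_comp.
- have FGe : \forall z \near c0 x, overlap c c' (F z) ->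
      G (F z) = transition c c' (F z).
    exact: (differentiable_continuous dF Ge).
  have c0cnear : \forall z \near c0 x, cube z -> overlap c0 c z.
    by apply: overlap_near; exists x.
  near=> z => c0c'z.
  have c0cz : overlap c0 c z.
    by move: (overlap_cube c0c'z); near: z; exact: c0cnear.
  have Fz : F z = transition c0 c z by move: (c0cz); near: z; exact: Fe.
  move: c0c'z c0cz => [x1 [c0x1 c'x1] zE] [x2 [c0x2 cx2] zE'].
  have x12 : x1 = x2 by rewrite -(chartK c0x1) -(chartK c0x2) zE zE'.
  subst x1.
  have {}Fz : F z = c x2 by rewrite Fz /transition /= -zE' chartK.
  have : G (F z) = transition c c' (F z).
    have : overlap c c' (F z) by rewrite Fz; exists x2.
    by near: z; exact: FGe.
  by rewrite /= => ->; rewrite Fz /transition /= -zE' !chartK.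
- have mxP (A B : 'M[R]_k) : (forall v : 'rV_k, v *m A = v *m B) -> A = B.
    by move=> AB; apply/row_matrixP => i; rewrite !rowE.
  have jE (H : 'rV[R]_k -> 'rV[R]_k) p (v : 'rV_k) : v *m 'J H p = 'd H p v.
    by rewrite /jacobian mul_rV_lin1.
  apply: mxP => v; rewrite -JF -JG; apply: (etrans (jE _ _ _)).
  apply: (etrans _ (esym (mulmxA _ _ _))).
  apply: (etrans _ (esym (congr1 (fun w => w *m _) (jE _ _ _)))).
  apply: (etrans _ (esym (jE _ _ _))).
  exact: (congr1 (fun h => h v) (diff_comp dF dG)).
Unshelve. all: by end_near. Qed.

End charts.

Arguments chart : clear implicits.
Arguments smooth_submanifold : clear implicits.

Section tangent_spaces.
Context {R : realType} {k : nat} {M : topologicalType}.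
Variables (S : smooth_submanifold R k M) (x : sm_set S).
Implicit Types (c : chart R k M).

Definition chart_at c : Prop := sm_atlas S c /\ chart_dom c (val x).

(* A tangent vector is the family of its coordinates in the charts at x (by
   convention 0 in other charts), related by the Jacobians of the transitions. *)
Definition tangent_pred : {pred chart R k M -> 'rV[R]_k} := fun v =>
  `[< (forall c, ~ chart_at c -> v c = 0) /\
      (forall c c' J, chart_at c -> chart_at c' ->
         jacobian_within (overlap c c') (transition c c') (c (val x)) J ->
         v c' = v c *m J) >].

Record tangent := Tangent {
  coordinates : chart R k M -> 'rV[R]_k;
  _ : coordinates \in tangent_pred }.

HB.instance Definition _ := [isSub for coordinates].
HB.instance Definition _ := [Choice of tangent by <:].

Lemma tangent_submod_closed : submod_closed tangent_pred.
Proof.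
split; first by apply/asboolP; split => // c c' J _ _ _; rewrite mul0mx.
move=> a u v /asboolP[u0 uJ] /asboolP[v0 vJ]; apply/asboolP; split => [c cx|].
  by rewrite !fctE u0// v0// scaler0 addr0.
move=> c c' J cx c'x jJ; rewrite !fctE mulmxDl -scalemxAl.
by rewrite (uJ _ _ _ cx c'x jJ) (vJ _ _ _ cx c'x jJ).
Qed.

HB.instance Definition _ :=
  GRing.isSubmodClosed.Build _ _ tangent_pred tangent_submod_closed.
HB.instance Definition _ := [SubChoice_isSubLmodule of tangent by <:].

Definition coord_in c (v : tangent) : 'rV[R]_k := coordinates v c.

Lemma coord_in_linear c : linear (coord_in c).
Proof. by []. Qed.

HB.instance Definition _ c :=
  GRing.isLinear.Build R tangent 'rV[R]_k _ (coord_in c) (coord_in_linear c).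

Lemma chart_atP : exists c, chart_at c.
Proof.
rewrite /chart_at; have := set_mem (valP x); move: (val x) => y.
by rewrite -(sm_cover S) => -[c Sc cx]; exists c.
Qed.

Lemma coord_in_bij c : chart_at c -> bijective (coord_in c).
Proof.
move=> cx.
have jac c1 c2 : chart_at c1 -> chart_at c2 -> exists J,
    jacobian_within (overlap c1 c2) (transition c1 c2) (c1 (val x)) J.
  move=> [Sc1 c1x] [Sc2 c2x].
  have /(sm_smooth Sc1 Sc2)[U [F [oU Ux sF FE]]] : overlap c1 c2 (c1 (val x)).
    by exists (val x).
  exists ('J F (c1 (val x))), F; split => //; first exact: (sF 1%N).1.
  by near=> z => Sz; apply: FE => //; near: z; exact: open_nbhs_nbhs.
pose J c' := xget 0
  (jacobian_within (overlap c c') (transition c c') (c (val x))).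
have JP c' : chart_at c' ->
    jacobian_within (overlap c c') (transition c c') (c (val x)) (J c').
  by move=> c'x; have [J0 J0P] := jac _ _ cx c'x; exact: (xgetI _ J0P).
pose t (w : 'rV[R]_k) c' : 'rV[R]_k := if `[< chart_at c' >] then w *m J c' else 0.
have tP w : t w \in tangent_pred.
  apply/asboolP; split => [c' c'x|c1 c2 J' c1x c2x J'P].
    by rewrite /t; case: asboolP.
  rewrite /t !asboolT// -mulmxA; congr (_ *m _).
  have := jacobian_transition_comp cx.2 c1x.2 c2x.2 (JP _ c1x) J'P.
  apply: jacobian_transition_uniq (JP _ c2x).
  by exists (val x) => //; split; [exact: cx.2 | exact: c2x.2].
exists (fun w => Tangent (tP w)) => [v|w /=].
  apply: val_inj; apply/funext => c' /=; rewrite /t.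
  have /asboolP[v0 vJ] := valP v.
  case: asboolP => c'x; last by rewrite v0.
  by rewrite -(vJ c c' _ cx c'x (JP _ c'x)).
rewrite /t asboolT// -[RHS]mulmx1; congr (_ *m _).
apply: (jacobian_transition_uniq _ (JP _ cx)).
  by exists (val x) => //; split; exact: cx.2.
exists id; split; first exact: ex_diff.
  near=> z => -[x' [cx' _] <-]; by rewrite /transition /= chartK.
by apply/matrixP => i j; rewrite mxE diff_val !mxE eqxx eq_sym.
Unshelve. all: by end_near. Qed.

Lemma tangent_vect_axiom : Vector.axiom k tangent.
Proof.
have [c cx] := cid chart_atP.
exists (coord_in c); first exact: coord_in_linear.
exact: coord_in_bij.
Qed.

HB.instance Definition _ := Lmodule_hasFinDim.Build R tangent tangent_vect_axiom.

(* The differential at x of the chart c. *)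
Definition chart_diff c : 'Hom(tangent, 'rV[R]_k) := linfun (coord_in c).

Definition tangent_orientation : set (k.-tuple tangent) :=
  [set e | forall c, chart_at c ->
     0 < \det (\matrix_(i < k) coord_in c (tnth e i))].

End tangent_spaces.

Section hausdorff_measure.
Context {R : realType} {T : Type}.
Variable d : T -> T -> R.
Local Open Scope ereal_scope.

Definition diameter (A : set T) : \bar R :=
  ereal_sup [set (d x.1 x.2)%:E | x in A `*` A].

(* Without the usual normalizing constant. *)
Definition hausdorff_content (s : nat) (delta : R) (E : set T) : \bar R :=
  ereal_inf
    [set \sum_(0 <= n <oo) (if `[< F n = set0 >] then 0 else diameter (F n) ^+ s)
    | F in [set F : (set T)^nat | E `<=` \bigcup_n F n /\
                                  forall n, diameter (F n) <= delta%:E]].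

Definition hausdorff_measure (s : nat) (E : set T) : \bar R :=
  ereal_sup [set hausdorff_content s delta E | delta in [set delta | (0 < delta)%R]].

End hausdorff_measure.

Definition distance_function (R : realType) (T : Type) (d : T -> T -> R) : Prop :=
  [/\ forall x y, 0 <= d x y,
      forall x y, d x y = 0 <-> x = y,
      forall x y, d x y = d y x &
      forall x y z, d x z <= d x y + d y z].

Section riemannian_metrics.
Context {R : realType} {k : nat} {M : topologicalType}.
Variable S : smooth_submanifold R k M.

Definition riemannian_metric
    (g : forall x : sm_set S, tangent x -> tangent x -> R) : Prop :=
  (forall x, inner_product (g x)) /\
  (forall c, sm_atlas S c -> exists2 G : 'rV[R]_k -> 'M[R]_k,
     smooth_within (c @` chart_dom c) G &
     forall (x : sm_set S) (u v : tangent x), chart_dom c (val x) ->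
       g x u v = (coord_in c u *m G (c (val x)) *m (coord_in c v)^T) 0 0).

Variables (d : M -> M -> R)
  (g : forall x : sm_set S, tangent x -> tangent x -> R).

Definition smooth_path_at (gamma : R -> M) (t : R) : Prop :=
  exists U c, [/\ open U, U t, sm_atlas S c, gamma @` U `<=` chart_dom c &
                  smooth U (c \o gamma : R^o -> 'rV[R]_k)].

Definition is_velocity (gamma : R -> M) (t : R) (x : sm_set S) (v : tangent x) :=
  val x = gamma t /\
  forall c, chart_at x c -> coord_in c v = derive1 (c \o gamma) t.

Definition speed (gamma : R -> M) (t : R) : R :=
  xget 0 [set s | exists (x : sm_set S) (v : tangent x),
                    is_velocity gamma t v /\ s = Num.sqrt (g v v)].

Definition path_length (gamma : R -> M) : \bar R :=
  (\int[lebesgue_measure]_(t in `[0%R, 1%R]) (speed gamma t)%:E)%E.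

(* Absolute continuity as a map to a metric space. *)
Definition absolutely_continuous_path (gamma : R -> M) : Prop :=
  exists2 m : R -> R, lebesgue_measure.-integrable `[0%R, 1%R] (EFin \o m) &
    forall s t, 0 <= s <= t -> t <= 1 ->
      ((d (gamma s) (gamma t))%:E <= \int[lebesgue_measure]_(r in `[s, t]) (m r)%:E)%E.

(* Continuous a.e. smooth paths.  Absolute continuity with respect to d is part
   of "a.e. smooth": without it, Cantor-like paths, which are a.e. locally
   constant, would join any two points of a chart with length 0. *)
Definition admissible_path (x y : M) : set (R -> M) :=
  [set gamma | [/\ gamma 0 = x /\ gamma 1 = y,
                   {within `[0, 1 : R], continuous gamma},
                   {ae lebesgue_measure,
                     forall t, 0 < t < 1 -> smooth_path_at gamma t} &
                   absolutely_continuous_path gamma]].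

End riemannian_metrics.

Record body_manifold (R : realType) (k : nat) := BodyManifold {
  bm_space :> topologicalType;
  bm_hausdorff : hausdorff_space bm_space;
  bm_compact : compact [set: bm_space];
  bm_connected : connected [set: bm_space];
  bm_atlas : set (chart R k bm_space);
  bm_oriented : oriented_topological_atlas bm_atlas;
  bm_dist : bm_space -> bm_space -> R;
  bm_distP : distance_function bm_dist;
  bm_smooth : smooth_submanifold R k bm_space;
  bm_smooth_oriented : forall c c',
    bm_atlas c -> sm_atlas bm_smooth c' -> same_orientation c c';
  bm_null : hausdorff_measure bm_dist k (~` sm_set bm_smooth) = 0%E;
  bm_metric : forall x : sm_set bm_smooth, tangent x -> tangent x -> R;
  bm_metricP : riemannian_metric bm_metric;
  bm_dist_inf : forall x y, (bm_dist x y)%:E = ereal_inf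
    [set path_length bm_metric gamma | gamma in admissible_path bm_smooth bm_dist x y] }.

Section energy_densities.
Context {R : realType} {k : nat}.
Implicit Types (M N : body_manifold R k).

Definition bm_point M : Type := sm_set (bm_smooth M).

Definition bm_tangent M (x : bm_point M) : vectType R := tangent x.

Definition deformation M (x : bm_point M) : Type := 'Hom(bm_tangent x, 'rV[R]_k).

Definition energy_density (F : body_manifold R k -> Prop) : Type :=
  forall M, F M -> forall x : bm_point M, deformation x -> R.

Definition normd M (x : bm_point M) (A : deformation x) : R :=
  frobenius (@bm_metric R k M x) euclidean A.

Definition Disd M (x : bm_point M) (A : deformation x) : R :=
  Dis (@bm_metric R k M x) (@tangent_orientation R k M _ x)
      euclidean standard_orientation A.

Definition DisL M N (x : bm_point M) (y : bm_point N)
    (L : 'Hom(bm_tangent x, bm_tangent y)) : R :=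
  Dis (@bm_metric R k M x) (@tangent_orientation R k M _ x)
      (@bm_metric R k N y) (@tangent_orientation R k N _ y) L.

(* Measurability in the base point is expressed in the local trivializations
   (x, B) |-> B \o dc_x of the bundle given by the charts c. *)
Definition caratheodory M (W : forall x : bm_point M, deformation x -> R) : Prop :=
  (forall c (B : 'End('rV[R]_k)), sm_atlas (bm_smooth M) c ->
     forall Y : set R, measurable Y ->
       <<s [set U : set M | open U] >>
         [set val x | x in [set x : bm_point M | chart_dom c (val x) /\
                              Y (W x (B \o chart_diff x c)%VF)]]) /\
  (forall (x : bm_point M) (A : deformation x) (eps : R), 0 < eps ->
     exists2 delta : R, 0 < delta &
       forall B : deformation x, normd (B - A) < delta -> `|W x B - W x A| < eps).

Definition p_regular (F : body_manifold R k -> Prop) (p : R)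
    (W : energy_density F) : Prop :=
  [/\ forall M (FM : F M), caratheodory (W M FM),
      exists alpha beta : R, [/\ 0 < alpha, 0 < beta &
        forall M (FM : F M) (x : bm_point M) (A : deformation x),
          alpha * normd A `^ p - beta <= W M FM x A],
      exists2 gamma : R, 0 < gamma &
        forall M (FM : F M) (x : bm_point M) (A : deformation x),
          W M FM x A <= gamma * (normd A `^ p + 1) &
      exists2 C : R, 0 < C &
        forall M N (FM : F M) (FN : F N) (x : bm_point M) (y : bm_point N)
          (L : 'Hom(bm_tangent x, bm_tangent y)) (A : deformation y),
          bijective L ->
          `|W M FM x (A \o L)%VF `^ p^-1 - W N FN y A `^ p^-1|
            <= C * (1 + normd A) * DisL L].

End energy_densities.

(* Main.v *)
From HB Require Import structures.
Require Import Defs.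
From mathcomp Require Import all_boot all_order all_algebra.
From mathcomp Require Import all_classical all_reals all_analysis.
From mathcomp Require Import measurable_realfun.
From mathcomp Require Import lra.
Import Order.TTheory GRing.Theory Num.Theory numFieldNormedType.Exports.
Local Open Scope classical_set_scope.
Local Open Scope ring_scope.
Set Implicit Arguments.
Unset Strict Implicit.
Unset Printing Implicit Defensive.

(** Everything is reduced to matrices. Once the source and the target of a
    linear map carry positively oriented orthonormal frames, the map becomes a
    k x k matrix, composition becomes matrix product, the Frobenius norm becomes
    the Euclidean norm of the entries [frobenius_frame], the isometries that
    preserve orientation become the rotation matrices [SO_frame], and so Dis A
    becomes the distance [rotation_dist] from a matrix to the rotations
    [Dis_frame].

    The growth bounds hold because every rotation has norm sqrt k, so that Dis A
    and |A| differ by at most sqrt k. Continuity on fibers holds because a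
    distance function is 1-Lipschitz.

    For the compatibility with a change of manifold, take rotations O and P.
    Row vectors being used, the matrix of the composite of L followed by A is
    L A, and |L A - O P| <= |L - O| |A| + |O (A - P)|, where the last term is
    |A - P| because O is an isometry. Taking infima over P and O bounds
    Dis (L A) - Dis A by |A| Dis L, and replacing P by O^-1 P bounds the opposite
    difference, so the constant C = 1 works [rotation_dist_mul].

    Measurability in the base point needs frames that depend well on the point.
    In a chart, the Gram-Schmidt process applied to the coordinate basis gives a
    frame that is a continuous function of the matrix of the metric
    [gram_schmidtP, gram_schmidt_cvg]. Hence the Dis of a map with a fixed matrix
    in the chart is continuous on the domain of the chart, and its p-th power is
    Borel there [Disd_chart_measurable]. *)

(** * The Frobenius norm of matrices *)

Section frobenius_norm_of_matrices.
Context {R : realType}.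

(** Lagrange's identity: the defect in the Cauchy-Schwarz inequality is half the
    sum of the squares of all the 2 x 2 minors of the pair (a, b). *)
Lemma sum_sqr_cauchy (I : finType) (a b : I -> R) :
  (\sum_i a i * b i) ^+ 2 <= (\sum_i a i ^+ 2) * (\sum_i b i ^+ 2).
Proof.
have E : \sum_i \sum_j (a i * b j - a j * b i) ^+ 2 =
    2 * ((\sum_i a i ^+ 2) * (\sum_i b i ^+ 2) - (\sum_i a i * b i) ^+ 2).
  under eq_bigr => i _.
    under eq_bigr => j _.
      rewrite (_ : _ ^+ 2 = a i ^+ 2 * b j ^+ 2 + b i ^+ 2 * a j ^+ 2
                            - 2 * ((a i * b i) * (a j * b j))); last by lra.
      over.
    rewrite big_split big_split /= sumrN -!mulr_sumr; over.
  rewrite big_split big_split /= sumrN -!mulr_sumr -!mulr_suml; lra.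
have : 0 <= \sum_i \sum_j (a i * b j - a j * b i) ^+ 2.
  by do 2!(apply: sumr_ge0 => ? _); exact: sqr_ge0.
rewrite E; lra.
Qed.

Definition fnorm m n (M : 'M[R]_(m, n)) : R :=
  Num.sqrt (\sum_i \sum_j M i j ^+ 2).

Lemma fnorm_ge0 m n (M : 'M[R]_(m, n)) : 0 <= fnorm M.
Proof. exact: sqrtr_ge0. Qed.

Lemma sum_sqr_ge0 m n (M : 'M[R]_(m, n)) : 0 <= \sum_i \sum_j M i j ^+ 2.
Proof. by do 2!(apply: sumr_ge0 => ? _); exact: sqr_ge0. Qed.

Lemma fnorm_sqr m n (M : 'M[R]_(m, n)) :
  fnorm M ^+ 2 = \sum_i \sum_j M i j ^+ 2.
Proof. by rewrite sqr_sqrtr// sum_sqr_ge0. Qed.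

Lemma fnormE m n (M : 'M[R]_(m, n)) : fnorm M = Num.sqrt (\tr (M *m M^T)).
Proof.
congr Num.sqrt; apply: eq_bigr => i _; rewrite mxE.
by apply: eq_bigr => j _; rewrite !mxE expr2.
Qed.

Lemma fnormN m n (M : 'M[R]_(m, n)) : fnorm (- M) = fnorm M.
Proof. by rewrite !fnormE linearN /= mulNmx mulmxN opprK. Qed.

Lemma ler_fnormD m n (M N : 'M[R]_(m, n)) : fnorm (M + N) <= fnorm M + fnorm N.
Proof.
rewrite -(@ler_sqr _ (fnorm (M + N))) ?nnegrE ?addr_ge0 ?fnorm_ge0//.
have -> : fnorm (M + N) ^+ 2 =
    fnorm M ^+ 2 + fnorm N ^+ 2 + 2 * \sum_i \sum_j M i j * N i j.
  rewrite !fnorm_sqr mulr_sumr -!big_split /=; apply: eq_bigr => i _.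
  rewrite mulr_sumr -!big_split /=; apply: eq_bigr => j _.
  by rewrite !mxE; lra.
suff : \sum_i \sum_j M i j * N i j <= fnorm M * fnorm N by rewrite sqrrD; lra.
rewrite (le_trans (ler_norm _))//.
rewrite -ler_sqr ?nnegrE ?mulr_ge0 ?fnorm_ge0// real_normK ?num_real//.
rewrite exprMn !fnorm_sqr !pair_bigA /=; exact: sum_sqr_cauchy.
Qed.

(** Cauchy-Schwarz applied to each entry of the product. *)
Lemma ler_fnormM m n p (M : 'M[R]_(m, n)) (N : 'M[R]_(n, p)) :
  fnorm (M *m N) <= fnorm M * fnorm N.
Proof.
rewrite -(@ler_sqr _ (fnorm (M *m N))) ?nnegrE ?mulr_ge0 ?fnorm_ge0//.
rewrite exprMn !fnorm_sqr mulr_suml; apply: ler_sum => i _.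
rewrite [X in _ <= _ * X]exchange_big mulr_sumr; apply: ler_sum => j _.
by rewrite mxE; exact: sum_sqr_cauchy.
Qed.

End frobenius_norm_of_matrices.

(** * The distance to the rotations *)

Section distance_to_rotations.
Context {R : realType} {k : nat}.
Implicit Types A L O P : 'M[R]_k.

(** For an orthogonal matrix a positive determinant equals 1; positivity is the
    form in which orientations provide the condition. *)
Definition rotation O : Prop := O *m O^T = 1%:M /\ 0 < \det O.

Lemma rotation1 : rotation (1%:M : 'M[R]_k).
Proof. by split; rewrite ?trmx1 ?mulmx1// det1. Qed.

Lemma rotationM O P : rotation O -> rotation P -> rotation (O *m P).
Proof.
move=> [OO dO] [PP dP]; split; last by rewrite det_mulmx mulr_gt0.
by rewrite trmx_mul mulmxA -(mulmxA O) PP mulmx1 OO.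
Qed.

Lemma rotation_tr O : rotation O -> rotation O^T.
Proof. by move=> [OO dO]; split; rewrite ?det_tr// trmxK; exact: mulmx1C. Qed.

Lemma fnorm_rotationl O A : rotation O -> fnorm (O *m A) = fnorm A.
Proof.
move=> [/mulmx1C OO _]; rewrite !fnormE trmx_mul mulmxA mxtrace_mulC.
by rewrite !mulmxA OO mul1mx.
Qed.

Lemma fnorm_rotation O : rotation O -> fnorm O = Num.sqrt k%:R.
Proof. by move=> [OO _]; rewrite fnormE OO mxtrace1. Qed.

Definition rotation_dist A : R := inf [set fnorm (A - O) | O in rotation].

Lemma rotation_dist_le A O : rotation O -> rotation_dist A <= fnorm (A - O).
Proof.
move=> rO; apply: ge_inf; last by exists O.
by exists 0 => _ [P _ <-]; exact: fnorm_ge0.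
Qed.

Lemma rotation_dist_ge A c :
  (forall O, rotation O -> c <= fnorm (A - O)) -> c <= rotation_dist A.
Proof.
move=> cA; apply: lb_le_inf.
  by exists (fnorm (A - 1%:M)), 1%:M => //; exact: rotation1.
by move=> _ [P rP <-]; exact: cA.
Qed.

Lemma rotation_dist_ge0 A : 0 <= rotation_dist A.
Proof. by apply: rotation_dist_ge => O _; exact: fnorm_ge0. Qed.

Lemma rotation_dist_le_fnorm A : rotation_dist A <= fnorm A + Num.sqrt k%:R.
Proof.
apply: (le_trans (rotation_dist_le _ rotation1)).
by rewrite -(fnorm_rotation rotation1) -(fnormN 1%:M) ler_fnormD.
Qed.

Lemma fnorm_le_rotation_dist A : fnorm A <= rotation_dist A + Num.sqrt k%:R.
Proof.
rewrite -lerBlDr; apply: rotation_dist_ge => O rO.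
rewrite lerBlDr -(fnorm_rotation rO) -{1}(subrK O A); exact: ler_fnormD.
Qed.

Lemma rotation_dist_lipschitz A B :
  `|rotation_dist A - rotation_dist B| <= fnorm (A - B).
Proof.
have H C D : rotation_dist C - rotation_dist D <= fnorm (C - D).
  rewrite lerBlDl -lerBlDr; apply: rotation_dist_ge => O rO.
  rewrite lerBlDr (le_trans (rotation_dist_le C rO))//.
  by rewrite -(subrK D C) -addrA addrC addrK ler_fnormD.
by rewrite ler_norml H andbT lerNl opprB -fnormN opprB H.
Qed.

(** Rotations act isometrically on matrices and permute themselves, so the
    distance from A to the rotations is that from O A, and L A differs from O A
    by (L - O) A. The infimum is taken over O at the end. *)
Lemma rotation_dist_mul L A :
  `|rotation_dist (L *m A) - rotation_dist A| <= fnorm A * rotation_dist L.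
Proof.
have H O : rotation O ->
    `|rotation_dist (L *m A) - rotation_dist A| <= fnorm A * fnorm (L - O).
  move=> rO.
  have -> : rotation_dist A = rotation_dist (O *m A).
    apply/eqP; rewrite eq_le; apply/andP; split; apply: rotation_dist_ge => P rP.
      rewrite -(fnorm_rotationl _ (rotation_tr rO)) mulmxBr mulmxA.
      rewrite (mulmx1C rO.1) mul1mx.
      by apply: rotation_dist_le; apply: rotationM => //; exact: rotation_tr.
    rewrite -(fnorm_rotationl _ rO) mulmxBr.
    by apply: rotation_dist_le; exact: rotationM.
  rewrite (le_trans (rotation_dist_lipschitz _ _))//.
  by rewrite -mulmxBl mulrC ler_fnormM.
(* Dividing by the norm of A, to pass to the infimum, requires it positive. *)
have [A0|A0] := eqVneq (fnorm A) 0.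
  by rewrite A0 mul0r (le_trans (H _ rotation1))// A0 mul0r.
have {}A0 : 0 < fnorm A by rewrite lt_neqAle eq_sym A0 fnorm_ge0.
rewrite -ler_pdivrMl//; apply: rotation_dist_ge => O rO.
by rewrite ler_pdivrMl// H.
Qed.

End distance_to_rotations.

(** * The Gram-Schmidt process *)

Section gram_schmidt.
Context {R : realType}.

Definition positive_definite n (G : 'M[R]_n) : Prop :=
  G^T = G /\ forall v : 'rV_n, v != 0 -> 0 < (v *m G *m v^T) 0 0.

(** The Schur complement of the top left entry. If G is the Gram matrix of a
    basis, this is the Gram matrix of the projections of the basis vectors other
    than the first onto the orthogonal complement of the first. *)
Definition schur n (G : 'M[R]_(1 + n)) : 'M[R]_n :=
  drsubmx G - (ulsubmx G 0 0)^-1 *: ((ursubmx G)^T *m ursubmx G).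

(** Row i holds the coordinates of the i-th orthonormalized vector, for the inner
    product with Gram matrix G. The first vector is normalized, and the process
    continues with the projections of the others, whose first coordinates
    account for the bottom left block. For positive definite G only square roots and
    inverses of positive numbers occur, whence the continuity in G. *)
Fixpoint gram_schmidt n : 'M[R]_n -> 'M[R]_n :=
  if n is n'.+1 return 'M[R]_n -> 'M[R]_n then
    fun G : 'M[R]_(1 + n') =>
      let a := ulsubmx G 0 0 in
      let E := gram_schmidt (schur G) in
      block_mx (Num.sqrt a)^-1%:M 0 (- a^-1 *: (E *m (ursubmx G)^T)) E
  else id.

(** The quadratic form of the Schur complement at w is that of G at the vector
    (c, w), with c chosen to make this vector orthogonal to the first one. *)
Lemma positive_definite_schur n (G : 'M[R]_(1 + n)) : positive_definite G ->
  0 < ulsubmx G 0 0 /\ positive_definite (schur G).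
Proof.
move=> [GT Gp]; set a := ulsubmx G 0 0.
have GE : G = block_mx a%:M (ursubmx G) (ursubmx G)^T (drsubmx G).
  by rewrite trmx_ursub GT -mx11_scalar submxK.
have a0 : 0 < a.
  have := Gp (row_mx 1%:M 0); rewrite GE mul_row_block tr_row_mx mul_row_col.
  rewrite trmx0 mulmx0 addr0 mul0mx addr0 mul1mx trmx1 mulmx1 mxE eqxx; apply.
  apply/eqP => /(congr1 lsubmx); rewrite row_mxKl => /matrixP/(_ 0 0).
  by rewrite !mxE => /eqP; rewrite oner_eq0.
split=> //; split.
  rewrite /schur linearB linearZ /= trmx_mul trmxK.
  by rewrite trmx_drsub GT.
move=> w w0.
pose b := ursubmx G; pose c := - a^-1 *: (w *m b^T).
have := Gp (row_mx c w).
have -> : row_mx c w *m G *m (row_mx c w)^T = w *m schur G *m w^T.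
  rewrite {1}GE mul_row_block tr_row_mx mul_row_col.
  have -> : c *m a%:M + w *m b^T = 0.
    rewrite /c mul_mx_scalar scalerA mulrN mulfV ?gt_eqF// scaleN1r.
    by rewrite addNr.
  rewrite mul0mx add0r; congr (_ *m _); rewrite /schur -/a -/b /c.
  by rewrite mulmxBr addrC -scalemxAl -scalemxAr scaleNr mulmxA.
apply; apply/eqP => /(congr1 rsubmx); rewrite row_mxKr => /eqP.
by rewrite linear0 (negbTE w0).
Qed.

Lemma gram_schmidtP n (G : 'M[R]_n) : positive_definite G ->
  gram_schmidt G *m G *m (gram_schmidt G)^T = 1%:M /\ 0 < \det (gram_schmidt G).
Proof.
elim: n G => [|n IH] G.
  by move=> _; split; [apply/matrixP => -[] | rewrite det_mx00].
move: G => G Gp; have [a0 Sp] := @positive_definite_schur n G Gp.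
have [SE Sd] := IH _ Sp.
rewrite /=; set E := gram_schmidt (schur G) in SE Sd *.
set a := (ulsubmx (_ : 'M[R]_(1 + n, 1 + n)) 0 0) in a0 *.
set b := ursubmx (_ : 'M[R]_(1 + n, 1 + n)).
set s := (Num.sqrt a)^-1.
have s0 : 0 < s by rewrite invr_gt0 sqrtr_gt0.
have saE : s * a * s = 1.
  rewrite -{1}(sqr_sqrtr (ltW a0)) /s expr2 mulrA mulVf ?mul1r ?mulfV//;
  by rewrite gt_eqF// sqrtr_gt0.
split; last by rewrite (@det_lblock _ 1 n) det_scalar1 mulr_gt0.
have GE : (G : 'M[R]_(1 + n)) = block_mx a%:M b b^T (drsubmx (G : 'M[R]_(1 + n))).
  by rewrite trmx_ursub (Gp.1 : G^T = G) -mx11_scalar submxK.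
rewrite [X in _ *m X *m _]GE (@mulmx_block _ 1 n 1 n 1 n).
rewrite !mul0mx !addr0.
have -> : - a^-1 *: (E *m b^T) *m a%:M + E *m b^T = 0.
  by rewrite mul_mx_scalar scalerA mulrN mulfV ?gt_eqF// scaleN1r addNr.
have -> : - a^-1 *: (E *m b^T) *m b + E *m drsubmx (G : 'M[R]_(1 + n)) =
    E *m schur G.
  by rewrite /schur mulmxBr addrC -scalemxAl -scalemxAr scaleNr mulmxA.
rewrite (@tr_block_mx _ 1 n 1 n) (@mulmx_block _ 1 n 1 n 1 n).
rewrite !mul0mx !trmx0 !mulmx0 !addr0 !add0r SE tr_scalar_mx.
rewrite -!scalar_mxM saE linearZ /= trmx_mul trmxK.
have -> : (s * a)%:M *m (- a^-1 *: (b *m E^T)) + s%:M *m b *m E^T = 0.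
  rewrite -mulmxA !mul_scalar_mx scalerA mulrN mulfK ?gt_eqF//.
  by rewrite scaleNr addNr.
by rewrite [RHS](@scalar_mx_block _ 1 n).
Qed.

End gram_schmidt.

(** * Frames and the passage to matrices *)

Section oriented_frames.
Context {R : realType} {k : nat}.

Lemma inner_product_suml (V : vectType R) (g : V -> V -> R) (I : finType)
    (a : I -> R) (e : I -> V) w : inner_product g ->
  g (\sum_i a i *: e i) w = \sum_i a i * g (e i) w.
Proof.
move=> [gl _ _].
have g0 : g 0 w = 0 by have := gl 1 0 0 w; rewrite scaler0 add0r mul1r; lra.
apply: (big_rec2 (fun v r => g v w = r)) => // i r v _ <-; exact: gl.
Qed.

Lemma inner_product_sumr (V : vectType R) (g : V -> V -> R) (I : finType)
    (a : I -> R) (e : I -> V) w : inner_product g ->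
  g w (\sum_i a i *: e i) = \sum_i a i * g w (e i).
Proof.
move=> ip; have [_ gC _] := ip; rewrite gC inner_product_suml//.
by apply: eq_bigr => i _; rewrite gC.
Qed.

(** The last field says that o is the orientation determined by e; in particular
    e is positively oriented. *)
Record oriented_frame (V : vectType R) (g : V -> V -> R) (o : set (k.-tuple V))
    (e : 'I_k -> V) : Prop := OrientedFrame {
  frame_orthonormal : forall i j, g (e i) (e j) = (i == j)%:R;
  frame_expansion : forall v, v = \sum_i g v (e i) *: e i;
  frame_orientation : forall t : k.-tuple V,
    o t <-> 0 < \det (\matrix_(i, j) g (tnth t i) (e j)) }.

Definition frame_mx (V W : vectType R) (h : W -> W -> R)
    (e : 'I_k -> V) (f : 'I_k -> W) (A : 'Hom(V, W)) : 'M[R]_k :=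
  \matrix_(i, j) h (A (e i)) (f j).

Lemma frame_mxB (V W : vectType R) (h : W -> W -> R)
    (e : 'I_k -> V) (f : 'I_k -> W) (A B : 'Hom(V, W)) : inner_product h ->
  frame_mx h e f (A - B) = frame_mx h e f A - frame_mx h e f B.
Proof.
move=> [hl _ _]; apply/matrixP => i j; rewrite !mxE add_lfunE opp_lfunE.
rewrite (_ : A (e i) - B (e i) = -1 *: B (e i) + A (e i)).
  by rewrite hl mulN1r addrC.
by rewrite scaleN1r addrC.
Qed.

Definition frame_coords (V : vectType R) (g : V -> V -> R) (e : 'I_k -> V)
  (v : V) : 'rV[R]_k := \row_i g v (e i).

Section two_frames.
Variables (V W : vectType R) (g : V -> V -> R) (h : W -> W -> R).
Variables (o : set (k.-tuple V)) (o' : set (k.-tuple W)).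
Variables (e : 'I_k -> V) (f : 'I_k -> W).
Hypotheses (ipg : inner_product g) (iph : inner_product h).
Hypotheses (fe : oriented_frame g o e) (ff : oriented_frame h o' f).
Implicit Types (A Q : 'Hom(V, W)) (M O : 'M[R]_k).

Lemma frame_inner_product (w w' : W) :
  h w w' = (frame_coords h f w *m (frame_coords h f w')^T) 0 0.
Proof.
rewrite {1}(frame_expansion ff w) inner_product_suml// mxE.
by have [_ hC _] := iph; apply: eq_bigr => i _; rewrite !mxE (hC _ w').
Qed.

Definition frame_hom M : 'Hom(V, W) :=
  linfun (fun v => \sum_j (\sum_i g v (e i) * M i j) *: f j).

Lemma frame_homE M v :
  frame_hom M v = \sum_j (\sum_i g v (e i) * M i j) *: f j.
Proof.
have lin : linear (fun v => \sum_j (\sum_i g v (e i) * M i j) *: f j).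
  move=> a u w; rewrite scaler_sumr -big_split /=; apply: eq_bigr => j _.
  rewrite scalerA -scalerDl; congr (_ *: _).
  rewrite mulr_sumr -big_split /=; apply: eq_bigr => i _.
  by have [gl _ _] := ipg; rewrite gl mulrDl mulrA.
pose F := GRing.isLinear.Build R V W _ _ lin.
pose Fl : {linear V -> W} :=
  HB.pack (fun v => \sum_j (\sum_i g v (e i) * M i j) *: f j) F.
by rewrite /frame_hom -[X in linfun X]/(Fl : V -> W) lfunE.
Qed.

Lemma frame_coords_hom M v :
  frame_coords h f (frame_hom M v) = frame_coords g e v *m M.
Proof.
apply/rowP => j; rewrite !mxE frame_homE inner_product_suml// (bigD1 j)//=.
rewrite (frame_orthonormal ff) eqxx mulr1 [X in _ + X]big1 ?addr0.
  by apply: eq_bigr => i _; rewrite mxE.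
by move=> i ij; rewrite (frame_orthonormal ff) (negbTE ij) mulr0.
Qed.

Lemma frame_homK M : frame_mx h e f (frame_hom M) = M.
Proof.
apply/matrixP => i j; rewrite mxE.
have /rowP/(_ j) := frame_coords_hom M (e i); rewrite !mxE => ->.
rewrite (bigD1 i)//= mxE (frame_orthonormal fe) eqxx mul1r big1 ?addr0// => l li.
by rewrite mxE (frame_orthonormal fe) eq_sym (negbTE li) mul0r.
Qed.

Lemma inner_frame_mx A v j :
  h (A v) (f j) = \sum_i g v (e i) * frame_mx h e f A i j.
Proof.
rewrite {1}(frame_expansion fe v) linear_sum /=.
under eq_bigr do rewrite linearZ /=.
by rewrite inner_product_suml//; apply: eq_bigr => i _; rewrite mxE.
Qed.

(** Existence of the adjoint: its value at w has the coordinates h w (A (e i)). *)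
Lemma adjointP A v w : g (adjoint g h A w) v = h w (A v).
Proof.
suff [B HB] : exists B : 'Hom(W, V), forall v w, g (B w) v = h w (A v).
  pose S := [set B : 'Hom(W, V) | forall v w, g (B w) v = h w (A v)].
  by have : S (adjoint g h A) by exact: (@xgetI _ 0 S B HB).
have lin : linear (fun w => \sum_i h w (A (e i)) *: e i).
  move=> a u w'; rewrite scaler_sumr -big_split /=; apply: eq_bigr => j _.
  by have [hl _ _] := iph; rewrite hl scalerA -scalerDl.
pose F := GRing.isLinear.Build R W V _ _ lin.
pose Fl : {linear W -> V} := HB.pack (fun w => \sum_i h w (A (e i)) *: e i) F.
exists (linfun Fl) => v' w'; rewrite lfunE /= inner_product_suml//.
rewrite {2}(frame_expansion fe v') linear_sum /=.
under [in RHS]eq_bigr do rewrite linearZ /=.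
rewrite inner_product_sumr//; apply: eq_bigr => i _; rewrite mulrC.
by have [_ gC _] := ipg; rewrite gC.
Qed.

(** The trace does not depend on the basis. With P the coordinates of the chosen
    basis in the frame, and N those of the images of the frame in the basis, the
    matrix of T is P N, while the matrix N P has the diagonal on the right. *)
Lemma lfun_trace_frame (T : 'End(V)) : lfun_trace T = \sum_i g (T (e i)) (e i).
Proof.
set b := vbasis {:V}.
pose P : 'M[R]_(\dim {:V}, k) := \matrix_(i, j) g b`_i (e j).
pose N : 'M[R]_(k, \dim {:V}) := \matrix_(j, l) coord b l (T (e j)).
rewrite /lfun_trace -/b.
have -> : passmx.mxof b b T = P *m N.
  apply/matrixP => i l; rewrite !mxE /= passmx.vecof_delta.
  rewrite {1}(frame_expansion fe b`_i) !linear_sum /=.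
  apply: eq_bigr => j _; rewrite !linearZ /=. by rewrite !mxE.
rewrite mxtrace_mulC; apply: eq_bigr => j _; rewrite mxE.
rewrite [in RHS](coord_basis (vbasisP fullv) (memvf (T (e j)))).
by rewrite inner_product_suml//; apply: eq_bigr => l _; rewrite !mxE.
Qed.

Lemma frobenius_frame A : frobenius g h A = fnorm (frame_mx h e f A).
Proof.
rewrite /frobenius /fnorm lfun_trace_frame; congr Num.sqrt.
apply: eq_bigr => i _; rewrite comp_lfunE adjointP frame_inner_product.
by rewrite mxE; apply: eq_bigr => j _; rewrite !mxE expr2.
Qed.

End two_frames.

Lemma frame_coords_inj (V : vectType R) (g : V -> V -> R)
    (o : set (k.-tuple V)) (e : 'I_k -> V) :
  oriented_frame g o e -> injective (frame_coords g e).
Proof.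
move=> fe v w /rowP vw; rewrite (frame_expansion fe v) (frame_expansion fe w).
by apply: eq_bigr => i _; have := vw i; rewrite !mxE => ->.
Qed.

Section rotations_in_frames.
Variables (V W : vectType R) (g : V -> V -> R) (h : W -> W -> R).
Variables (o : set (k.-tuple V)) (o' : set (k.-tuple W)).
Variables (e : 'I_k -> V) (f : 'I_k -> W).
Hypotheses (ipg : inner_product g) (iph : inner_product h).
Hypotheses (fe : oriented_frame g o e) (ff : oriented_frame h o' f).

(** An isometry sends the frame e to an orthonormal family, and e is positively
    oriented, whence a rotation matrix. Conversely the transpose of a rotation
    matrix is its inverse, and the determinant of the coordinates of a basis is
    multiplied by a positive number. *)
Lemma SO_frame : [set frame_mx h e f Q | Q in SO g o h o'] = rotation.
Proof.
apply/seteqP; split=> [_ [Q [bQ isoQ oQ] <-]|O rO].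
  split.
    apply/matrixP => i j; rewrite !mxE -(frame_orthonormal fe) -isoQ.
    rewrite (frame_inner_product iph ff) mxE.
    by apply: eq_bigr => l _; rewrite !mxE.
  have /oQ /(frame_orientation ff) : o (mktuple e).
    apply/(frame_orientation fe); rewrite (_ : \matrix_(_, _) _ = 1%:M) ?det1//.
    by apply/matrixP => i j; rewrite !mxE tnth_mktuple (frame_orthonormal fe).
  rewrite (_ : \matrix_(_, _) _ = frame_mx h e f Q)//.
  by apply/matrixP => i j; rewrite !mxE tnth_map tnth_mktuple.
exists (frame_hom g e f O); last exact: (frame_homK ipg iph fe ff).
split.
- exists (frame_hom h f e O^T) => v.
    apply: (frame_coords_inj fe).
    rewrite (frame_coords_hom _ iph ipg fe) (frame_coords_hom _ ipg iph ff).
    by rewrite -mulmxA rO.1 mulmx1.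
  apply: (frame_coords_inj ff).
  rewrite (frame_coords_hom _ ipg iph ff) (frame_coords_hom _ iph ipg fe).
  by rewrite -mulmxA (mulmx1C rO.1) mulmx1.
- move=> u v; rewrite (frame_inner_product iph ff) (frame_inner_product ipg fe).
  rewrite !(frame_coords_hom _ ipg iph ff) trmx_mul mulmxA -(mulmxA _ O) rO.1.
  by rewrite mulmx1.
- move=> t /(frame_orientation fe) dt; apply/(frame_orientation ff).
  rewrite (_ : \matrix_(_, _) _ = (\matrix_(i, j) g (tnth t i) (e j)) *m O).
    by rewrite det_mulmx mulr_gt0// rO.2.
  apply/matrixP => i j; rewrite !mxE tnth_map.
  have /rowP/(_ j) := frame_coords_hom e ipg iph ff O (tnth t i).
  by rewrite !mxE => ->; apply: eq_bigr => l _; rewrite !mxE.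
Qed.

Lemma Dis_frame A : Dis g o h o' A = rotation_dist (frame_mx h e f A).
Proof.
rewrite /Dis /rotation_dist -SO_frame; congr inf; apply/seteqP; split.
  move=> _ [Q SQ <-]; exists (frame_mx h e f Q); first by exists Q.
  by rewrite (frobenius_frame ipg iph fe ff) frame_mxB.
move=> _ [_ [Q SQ <-] <-]; exists Q => //.
by rewrite (frobenius_frame ipg iph fe ff) frame_mxB.
Qed.

End rotations_in_frames.

Lemma frame_mx_comp (U V W : vectType R) (g : V -> V -> R) (h : W -> W -> R)
    (o : set (k.-tuple V)) (c : 'I_k -> U) (e : 'I_k -> V) (f : 'I_k -> W)
    (L : 'Hom(U, V)) (A : 'Hom(V, W)) :
  inner_product h -> oriented_frame g o e ->
  frame_mx h c f (A \o L)%VF = frame_mx g c e L *m frame_mx h e f A.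
Proof.
move=> iph fe; apply/matrixP => i j; rewrite !mxE comp_lfunE.
by rewrite (inner_frame_mx f iph fe); apply: eq_bigr => l _; rewrite !mxE.
Qed.

End oriented_frames.

(** * Frames of Euclidean space and of tangent spaces *)

Section standard_frame.
Context {R : realType} {k : nat}.

Definition standard_frame (i : 'I_k) : 'rV[R]_k := delta_mx 0 i.

Lemma euclidean_standard (v : 'rV[R]_k) i : euclidean v (standard_frame i) = v 0 i.
Proof. by rewrite /euclidean /standard_frame trmx_delta -colE mxE. Qed.

Lemma inner_product_euclidean : inner_product (@euclidean R k).
Proof.
split=> [a u v w|u v|u u0].
- by rewrite /euclidean mulmxDl -scalemxAl !mxE.
- by rewrite /euclidean -[v *m u^T]trmxK trmx_mul trmxK [RHS]mxE.
rewrite /euclidean mxE lt_neqAle sumr_ge0 => [|i _]; last first.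
  by rewrite mxE -expr2 sqr_ge0.
rewrite andbT eq_sym psumr_neq0 => [|i _]; last by rewrite mxE -expr2 sqr_ge0.
apply/hasP; case/rV0Pn: u0 => i ui; exists i; first by rewrite mem_index_enum.
by rewrite /= mxE -expr2 exprn_even_gt0.
Qed.

Lemma oriented_frame_standard :
  oriented_frame euclidean standard_orientation standard_frame.
Proof.
split=> [i j|v|t].
- by rewrite euclidean_standard mxE eqxx eq_sym.
- rewrite {1}[v]row_sum_delta; apply: eq_bigr => i _.
  by rewrite euclidean_standard.
rewrite /standard_orientation /=.
suff -> : \matrix_i tnth t i =
  \matrix_(i, j) euclidean (tnth t i) (standard_frame j) by [].
by apply/matrixP => i j; rewrite !mxE euclidean_standard.
Qed.

End standard_frame.

Section tangent_frames.
Context {R : realType} {k : nat} {M : topologicalType}.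
Variables (S : smooth_submanifold R k M) (x : sm_set S).
Variables (g : tangent x -> tangent x -> R) (c : chart R k M) (G : 'M[R]_k).
Hypotheses (ipg : inner_product g) (cx : chart_at x c).
Hypothesis gE : forall u v, g u v = (coord_in c u *m G *m (coord_in c v)^T) 0 0.

Lemma positive_definite_chart : positive_definite G.
Proof.
have [inv coordK invK] := coord_in_bij cx; have [_ gC g0] := ipg; split.
  apply/matrixP => i j.
  have GE a b : G a b = g (inv (delta_mx 0 a)) (inv (delta_mx 0 b)).
    by rewrite gE !invK trmx_delta -rowE -colE !mxE.
  by rewrite mxE !GE gC.
move=> v v0; have := g0 (inv v); rewrite gE invK; apply.
apply/eqP => iv0; move: v0; rewrite -(invK v) iv0.
by rewrite (linear0 (coord_in c)) eqxx.
Qed.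

(** The Jacobians of the transitions between smooth charts have positive
    determinant, so a single chart decides. *)
Lemma tangent_orientation_chart (t : k.-tuple (tangent x)) :
  tangent_orientation t <-> 0 < \det (\matrix_i coord_in c (tnth t i)).
Proof.
split=> [|tc c' c'x]; first exact.
have [Sc cxx] := cx; have [Sc' c'xx] := c'x.
have ov : overlap c c' (c (val x)) by exists (val x).
have [U [H [oU Ux sH HE]]] := sm_smooth Sc Sc' ov.
have jH : jacobian_within (overlap c c') (transition c c') (c (val x))
    ('J H (c (val x))).
  exists H; split => //; first exact: (sH 1%N).1.
  by near=> z => Sz; apply: HE => //; near: z; exact: open_nbhs_nbhs.
have -> : \matrix_i coord_in c' (tnth t i) =
    (\matrix_i coord_in c (tnth t i)) *m 'J H (c (val x)).
  apply/row_matrixP => i; rewrite row_mul !rowK.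
  have /asboolP[_ vJ] := valP (tnth t i); exact: (vJ c c' _ cx c'x jH).
rewrite det_mulmx mulr_gt0// (sm_oriented Sc Sc' ov jH).
Unshelve. all: by end_near. Qed.

(** The rows of E are the coordinates of vectors that are orthonormal for the
    inner product with matrix G in the chart. *)
Lemma tangent_frame (E : 'M[R]_k) :
  E *m G *m E^T = 1%:M -> 0 < \det E ->
  exists2 e : 'I_k -> tangent x,
    oriented_frame g (@tangent_orientation R k M S x) e &
    forall i, coord_in c (e i) = row i E.
Proof.
move=> EG dE; have [inv coordK invK] := coord_in_bij cx.
have GE1 : G *m E^T *m E = 1%:M by apply: mulmx1C; rewrite mulmxA.
have gvE v i : g v (inv (row i E)) = (coord_in c v *m (G *m E^T)) 0 i.
  by rewrite gE invK tr_row colE !mulmxA -colE [LHS]mxE.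
exists (fun i => inv (row i E)) => [|i]; last exact: invK.
split=> [i j|v|t].
- by rewrite gvE invK -row_mul mulmxA EG !mxE.
- apply: (can_inj coordK); rewrite linear_sum.
  under eq_bigr => i _ do rewrite linearZ /= invK gvE.
  by rewrite -mulmx_sum_row -mulmxA GE1 mulmx1.
rewrite tangent_orientation_chart; set X := (X in \det X).
have -> : \matrix_(i, j) g (tnth t i) (inv (row j E)) = X *m (G *m E^T).
  apply/matrixP => i j; rewrite mxE gvE -(rowK (fun i => coord_in c (tnth t i)) i).
  by rewrite -row_mul [LHS]mxE.
have {1}-> : X = X *m (G *m E^T) *m E by rewrite -mulmxA GE1 mulmx1.
by rewrite det_mulmx pmulr_lgt0.
Qed.

End tangent_frames.

(** * Continuity of the Gram-Schmidt process *)

Section entrywise_convergence.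
Context {R : realType} {T : Type} (F : set_system T) {FF : Filter F}.

(** Convergence entry by entry reduces every algebraic operation on matrices to
    limits of real functions, in all dimensions including 0. *)
Definition mx_cvg m n (A : T -> 'M[R]_(m, n)) (B : 'M[R]_(m, n)) : Prop :=
  forall i j, A t i j @[t --> F] --> B i j.

Lemma sum_cvg (I : finType) (f : I -> T -> R) (a : I -> R) :
  (forall i, f i t @[t --> F] --> a i) ->
  \sum_i f i t @[t --> F] --> \sum_i a i.
Proof.
by move=> fa; apply: cvg_big => [|i _]; [exact: add_continuous|exact: fa].
Qed.

Lemma mx_cvg_cst m n (A : 'M[R]_(m, n)) : mx_cvg (fun=> A) A.
Proof. by move=> i j; exact: cvg_cst. Qed.

Lemma mx_cvgM m n p (A : T -> 'M[R]_(m, n)) (B : T -> 'M[R]_(n, p)) A0 B0 :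
  mx_cvg A A0 -> mx_cvg B B0 -> mx_cvg (fun t => A t *m B t) (A0 *m B0).
Proof.
move=> AA0 BB0 i j; rewrite mxE; under eq_cvg do rewrite mxE.
by apply: sum_cvg => l; apply: cvgM; [exact: AA0|exact: BB0].
Qed.

Lemma mx_cvg_tr m n (A : T -> 'M[R]_(m, n)) A0 :
  mx_cvg A A0 -> mx_cvg (fun t => (A t)^T) A0^T.
Proof. by move=> AA0 i j; rewrite mxE; under eq_cvg do rewrite mxE; exact: AA0. Qed.

Lemma mx_cvgB m n (A B : T -> 'M[R]_(m, n)) A0 B0 :
  mx_cvg A A0 -> mx_cvg B B0 -> mx_cvg (fun t => A t - B t) (A0 - B0).
Proof.
move=> AA0 BB0 i j; rewrite !mxE; under eq_cvg do rewrite !mxE.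
by apply: cvgB; [exact: AA0|exact: BB0].
Qed.

Lemma mx_cvgZ m n (a : T -> R) (A : T -> 'M[R]_(m, n)) (a0 : R) A0 :
  a t @[t --> F] --> a0 -> mx_cvg A A0 ->
  mx_cvg (fun t => a t *: A t) (a0 *: A0).
Proof.
move=> aa0 AA0 i j; rewrite mxE; under eq_cvg do rewrite mxE.
by apply: cvgM; [exact: aa0|exact: AA0].
Qed.

Lemma mx_cvg_block m1 m2 n1 n2 (A : T -> 'M[R]_(m1, n1)) (B : T -> 'M[R]_(m1, n2))
    (C : T -> 'M[R]_(m2, n1)) (D : T -> 'M[R]_(m2, n2)) A0 B0 C0 D0 :
  mx_cvg A A0 -> mx_cvg B B0 -> mx_cvg C C0 -> mx_cvg D D0 ->
  mx_cvg (fun t => block_mx (A t) (B t) (C t) (D t)) (block_mx A0 B0 C0 D0).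
Proof.
move=> hA hB hC hD i j.
case: (split_ordP i) => i' ->; case: (split_ordP j) => j' ->.
- by rewrite block_mxEul; under eq_cvg do rewrite block_mxEul; exact: hA.
- by rewrite block_mxEur; under eq_cvg do rewrite block_mxEur; exact: hB.
- by rewrite block_mxEdl; under eq_cvg do rewrite block_mxEdl; exact: hC.
- by rewrite block_mxEdr; under eq_cvg do rewrite block_mxEdr; exact: hD.
Qed.

Lemma fnorm_cvg0 m n (A : T -> 'M[R]_(m, n)) A0 :
  mx_cvg A A0 -> fnorm (A t - A0) @[t --> F] --> 0.
Proof.
move=> AA0; rewrite -[X in _ --> X]sqrtr0.
apply: continuous_cvg; first exact: sqrt_continuous.
have E : \sum_(i < m) \sum_(j < n) (0 : R) = 0.
  by rewrite big1// => i _; rewrite big1.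
rewrite -[X in _ --> X]E.
apply: sum_cvg => i; apply: sum_cvg => j.
have AA0ij : (A t - A0) i j @[t --> F] --> (0 : R).
  rewrite -(subrr (A0 i j)); under eq_cvg do rewrite !mxE.
  by apply: cvgB; [exact: AA0|exact: cvg_cst].
by rewrite -[X in _ --> X](mulr0 0); under eq_cvg do rewrite expr2; exact: cvgM.
Qed.

Lemma rotation_dist_cvg n (A : T -> 'M[R]_n) A0 :
  mx_cvg A A0 -> rotation_dist (A t) @[t --> F] --> rotation_dist A0.
Proof.
move=> /fnorm_cvg0 AA0; apply/cvgrPdist_lt => eps eps0.
move/cvgrPdist_lt: AA0 => /(_ _ eps0); apply: filterS => t.
rewrite sub0r normrN ger0_norm ?fnorm_ge0// => /le_lt_trans; apply.
by rewrite distrC; exact: rotation_dist_lipschitz.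
Qed.

Lemma gram_schmidt_cvg n (G : T -> 'M[R]_n) G0 : positive_definite G0 ->
  mx_cvg G G0 -> mx_cvg (fun t => gram_schmidt (G t)) (gram_schmidt G0).
Proof.
elim: n G G0 => [//|n IH] G G0 pG0 GG0.
have [a0 pS] := @positive_definite_schur _ n G0 pG0.
have ul : mx_cvg (fun t => ulsubmx (G t : 'M[R]_(1 + n)))
  (ulsubmx (G0 : 'M[R]_(1 + n))).
  by move=> i j; rewrite !mxE; under eq_cvg do rewrite !mxE; exact: GG0.
have ur : mx_cvg (fun t => ursubmx (G t : 'M[R]_(1 + n)))
  (ursubmx (G0 : 'M[R]_(1 + n))).
  by move=> i j; rewrite !mxE; under eq_cvg do rewrite !mxE; exact: GG0.
have dr : mx_cvg (fun t => drsubmx (G t : 'M[R]_(1 + n)))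
  (drsubmx (G0 : 'M[R]_(1 + n))).
  by move=> i j; rewrite !mxE; under eq_cvg do rewrite !mxE; exact: GG0.
have aV := cvgV (lt0r_neq0 a0) (ul 0 0).
have SS : mx_cvg (fun t => schur (G t : 'M[R]_(1 + n)))
  (schur (G0 : 'M[R]_(1 + n))).
  apply: mx_cvgB => //; apply: mx_cvgZ; first exact: aV.
  by apply: mx_cvgM => //; exact: mx_cvg_tr.
have EE := IH _ _ pS SS.
apply: (@mx_cvg_block 1 n 1 n) => //.
- move=> i j; rewrite mxE; under eq_cvg do rewrite mxE.
  apply: cvgMn; apply: cvgV; first by rewrite gt_eqF// sqrtr_gt0.
  by apply: continuous_cvg; [exact: sqrt_continuous|exact: (ul 0 0)].
- exact: mx_cvg_cst.
- apply: mx_cvgZ; first by apply: cvgN; exact: aV.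
  by apply: (mx_cvgM EE); exact: mx_cvg_tr.
Qed.

End entrywise_convergence.

(** * Real powers and Borel preimages *)

Section powers.
Context {R : realType}.
Implicit Types a b eps p : R.

(** The bases are restricted to nonnegative numbers because x `^ p is 1 for
    negative x, which makes it discontinuous at 0. *)
Lemma powR_continuous_nneg p a eps : 0 < p -> 0 <= a -> 0 < eps ->
  exists2 delta : R, 0 < delta &
    forall b, 0 <= b -> `|b - a| < delta -> `|b `^ p - a `^ p| < eps.
Proof.
move=> p0; rewrite le_eqVlt => /predU1P[<-|a0] eps0.
  exists (eps `^ p^-1) => [|b b0]; first exact: powR_gt0.
  rewrite powR0 ?gt_eqF// !subr0 !ger0_norm ?powR_ge0// => be.
  have -> : eps = (eps `^ p^-1) `^ p.
    by rewrite -powRrM mulVf ?gt_eqF// powRr1// ltW.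
  by apply: gt0_ltr_powR => //; rewrite nnegrE ?powR_ge0.
have : {for a, continuous (fun x : R => x `^ p)}.
  apply: differentiable_continuous; apply/derivable1_diffP.
  by apply: derivable_powR; rewrite in_itv /= a0.
move=> /cvgrPdist_lt/(_ _ eps0)/nbhs_ballP[d /= d0 dP].
exists d => // b _ ba; rewrite distrC; apply: dP.
by rewrite /ball /= distrC.
Qed.

(** Both sides are compared with the p-th power of 2 max(a, b). *)
Lemma powRD_le p a b : 0 < p -> 0 <= a -> 0 <= b ->
  (a + b) `^ p <= 2 `^ p * (a `^ p + b `^ p).
Proof.
move=> p0 a0 b0; wlog ab : a b a0 b0 / b <= a.
  move=> H; have [/H|/ltW/H] := leP b a; first exact.
  by rewrite addrC [X in _ * X]addrC; exact.
apply: (@le_trans _ _ (2 `^ p * a `^ p)).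
  rewrite -powRM//; apply: ge0_ler_powR; rewrite ?nnegrE ?(ltW p0)//.
  - exact: addr_ge0.
  - exact: mulr_ge0.
  - lra.
by rewrite ler_pM2l ?powR_gt0// lerDl powR_ge0.
Qed.

End powers.

(** The sets Y whose preimage has a Borel trace on D form a sigma-algebra, which
    contains the open intervals since phi is continuous on the open set D. *)
Lemma borel_preimage_continuous (R : realType) (T : topologicalType) (D : set T)
    (phi : T -> R) (Y : set R) :
  open D -> (forall x, D x -> {for x, continuous phi}) -> measurable Y ->
  <<s [set U : set T | open U] >> (D `&` phi @^-1` Y).
Proof.
move=> oD cphi mY.
have [s0 sC sU] := smallest_sigma_algebra [set: T] [set U : set T | open U].
have sD : <<s [set U : set T | open U] >> D by apply: sub_sigma_algebra.
have : (@ocitv R).-sigma.-measurable Y by exact: mY.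
rewrite RGenOpens.measurableE; move: Y {mY}; apply: smallest_sub.
  split.
  - by rewrite preimage_set0 setI0.
  - move=> Y sY.
    (* The intersection is written with complements and a union. *)
    have -> : D `&` phi @^-1` ([set: R] `\` Y) =
        [set: T] `\` (([set: T] `\` D) `|` (D `&` phi @^-1` Y)).
      apply/seteqP; split => x /=; first by tauto.
      by move=> [_ H]; split; apply: contrapT; tauto.
    rewrite -bigcup2E; apply: (sC); apply: sU => -[|[|n]] //=.
    by apply: sC.
  - move=> Y sY; rewrite preimage_bigcup setI_bigcupr; exact: sU.
move=> _ [x [y ->]]; apply: sub_sigma_algebra => /=.
rewrite openE => t [Dt phit]; apply: filterI; first exact: open_nbhs_nbhs.
apply: cphi => //; apply: open_nbhs_nbhs; split => //; exact: interval_open.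
Qed.

(** * Body manifolds and the energy density *)

Section body_manifolds.
Context {R : realType} {k : nat}.
Implicit Types M N : body_manifold R k.

Lemma gram_schmidt_frame M (c : chart R k M) (G : 'rV[R]_k -> 'M[R]_k) :
  sm_atlas (bm_smooth M) c ->
  (forall (x : bm_point M) (u v : tangent x), chart_dom c (val x) ->
     bm_metric u v =
       (coord_in c u *m G (c (val x)) *m (coord_in c v)^T) 0 0) ->
  forall x : bm_point M, chart_dom c (val x) ->
    positive_definite (G (c (val x))) /\
    exists2 e : 'I_k -> bm_tangent x,
      oriented_frame (@bm_metric R k M x) (@tangent_orientation R k M _ x) e &
      forall i, coord_in c (e i) = row i (gram_schmidt (G (c (val x)))).
Proof.
move=> Sc GE x cx; have ipg := (bm_metricP M).1 x.
have pG := positive_definite_chart ipg (conj Sc cx) (fun u v => GE x u v cx).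
have [EG dE] := gram_schmidtP pG.
by split=> //; exact: (tangent_frame (conj Sc cx) (fun u v => GE x u v cx) EG dE).
Qed.

Lemma bm_frame M (x : bm_point M) : exists e : 'I_k -> bm_tangent x,
  oriented_frame (@bm_metric R k M x) (@tangent_orientation R k M _ x) e.
Proof.
have [c [Sc cx]] := chart_atP x.
have [G _ GE] := (bm_metricP M).2 c Sc.
by have [_ [e fe _]] := gram_schmidt_frame Sc GE cx; exists e.
Qed.

Section deformations_in_frames.
Variables (M : body_manifold R k) (x : bm_point M) (e : 'I_k -> bm_tangent x).
Hypothesis fe :
  oriented_frame (@bm_metric R k M x) (@tangent_orientation R k M _ x) e.

Lemma normd_frame (A : deformation x) :
  normd A = fnorm (frame_mx euclidean e (@standard_frame R k) A).
Proof.
exact: (frobenius_frame ((bm_metricP M).1 x) (@inner_product_euclidean R k) fe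
  (@oriented_frame_standard R k)).
Qed.

Lemma Disd_frame (A : deformation x) :
  Disd A = rotation_dist (frame_mx euclidean e (@standard_frame R k) A).
Proof.
exact: (Dis_frame ((bm_metricP M).1 x) (@inner_product_euclidean R k) fe
  (@oriented_frame_standard R k)).
Qed.

End deformations_in_frames.

Lemma Disd_ge0 M (x : bm_point M) (A : deformation x) : 0 <= Disd A.
Proof. by have [e fe] := bm_frame x; rewrite (Disd_frame fe) rotation_dist_ge0. Qed.

Lemma normd_ge0 M (x : bm_point M) (A : deformation x) : 0 <= normd A.
Proof. exact: sqrtr_ge0. Qed.

Lemma Disd_le M (x : bm_point M) (A : deformation x) :
  Disd A <= normd A + Num.sqrt k%:R.
Proof.
have [e fe] := bm_frame x.
by rewrite (Disd_frame fe) (normd_frame fe) rotation_dist_le_fnorm.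
Qed.

Lemma normd_le M (x : bm_point M) (A : deformation x) :
  normd A <= Disd A + Num.sqrt k%:R.
Proof.
have [e fe] := bm_frame x.
by rewrite (Disd_frame fe) (normd_frame fe) fnorm_le_rotation_dist.
Qed.

Lemma Disd_lipschitz M (x : bm_point M) (A B : deformation x) :
  `|Disd A - Disd B| <= normd (A - B).
Proof.
have [e fe] := bm_frame x; rewrite !(Disd_frame fe) (normd_frame fe).
by rewrite (frame_mxB _ _ _ _ (@inner_product_euclidean R k)) rotation_dist_lipschitz.
Qed.

(** The estimate behind the comparison of two manifolds: it is the matrix estimate
    [rotation_dist_mul], read in frames at x and y. *)
Lemma Disd_comp M N (x : bm_point M) (y : bm_point N)
    (L : 'Hom(bm_tangent x, bm_tangent y)) (A : deformation y) :
  `|Disd (A \o L)%VF - Disd A| <= normd A * DisL L.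
Proof.
have [e fe] := bm_frame x; have [f ff] := bm_frame y.
have ipx := (bm_metricP M).1 x; have ipy := (bm_metricP N).1 y.
rewrite (Disd_frame fe) (Disd_frame ff) (normd_frame ff).
rewrite (frame_mx_comp _ _ _ _ (@inner_product_euclidean R k) ff).
rewrite /DisL (Dis_frame ipx ipy fe ff); exact: rotation_dist_mul.
Qed.

(** In the frame obtained from the chart by Gram-Schmidt, the map has the matrix E B
    where B is fixed and E depends continuously on the base point through the
    matrix of the metric. *)
Lemma Disd_chart_measurable M (c : chart R k M) (B : 'End('rV[R]_k))
    (Y : set R) : sm_atlas (bm_smooth M) c -> measurable Y ->
  <<s [set U : set M | open U] >>
    [set val x | x in [set x : bm_point M |
       chart_dom c (val x) /\ Y (Disd (B \o chart_diff x c)%VF)]].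
Proof.
move=> Sc mY; have [G sG GE] := (bm_metricP M).2 c Sc.
pose phi (m : M) := rotation_dist (gram_schmidt (G (c m)) *m
  frame_mx euclidean (@standard_frame R k) (@standard_frame R k) B).
have phiE (x : bm_point M) : chart_dom c (val x) ->
    Disd (B \o chart_diff x c)%VF = phi (val x).
  move=> cx; have [_ [e fe eE]] := gram_schmidt_frame Sc GE cx.
  rewrite (Disd_frame fe).
  rewrite (frame_mx_comp _ _ _ _ (@inner_product_euclidean R k)
    (@oriented_frame_standard R k)).
  congr (rotation_dist (_ *m _)); apply/matrixP => i j.
  by rewrite mxE euclidean_standard lfunE /= eE mxE.
have -> : [set val x | x in [set x : bm_point M |
       chart_dom c (val x) /\ Y (Disd (B \o chart_diff x c)%VF)]] =
    chart_dom c `&` phi @^-1` Y.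
  apply/seteqP; split=> [_ [x [cx Yx] <-]|m [cm Ym]].
    by split => //=; rewrite -phiE.
  have Sm : m \in sm_set (bm_smooth M).
    by apply/mem_set; rewrite -(sm_cover (bm_smooth M)); exists c.
  pose x : bm_point M := SigSub Sm.
  by exists x => //; split => //; rewrite phiE.
apply: borel_preimage_continuous => //; first exact: chart_open.
move=> m cm.
have Sm : m \in sm_set (bm_smooth M).
  by apply/mem_set; rewrite -(sm_cover (bm_smooth M)); exists c.
pose x : bm_point M := SigSub Sm.
have [pG _] := gram_schmidt_frame Sc GE (x := x) cm.
have cc : {for m, continuous c}.
  have := @chart_cont _ _ _ c; rewrite continuous_open_subspace; last exact: chart_open.
  by apply; exact/mem_set.
have [U [H [oU Um sH HG]]] : exists U (H : 'rV[R]_k -> 'M[R]_k),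
    [/\ open U, U (c m), smooth U H &
        forall z, U z -> (c @` chart_dom c) z -> H z = G z].
  by apply: sG; exists m.
apply: rotation_dist_cvg; apply: mx_cvgM; last exact: mx_cvg_cst.
apply: gram_schmidt_cvg => // i j.
(* The matrix G of the metric is smooth only on the image of the chart; H is a
   smooth extension around c m, and agrees with G along c. *)
have HGm : \forall t \near m, H (c t) = G (c t).
  have Uc : \forall t \near m, U (c t).
    by apply: cc; apply: open_nbhs_nbhs.
  have Dm : \forall t \near m, chart_dom c t.
    by apply: open_nbhs_nbhs; split => //; exact: chart_open.
  near=> t; apply: HG; first by near: t.
  by exists t => //; near: t.
rewrite -(nbhs_singleton HGm).
have Hc : {for m, continuous (fun t => H (c t) i j)}.
  apply: (@continuous_comp _ _ _ (H \o c) (fun A : 'M[R]_k => A i j)).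
    by apply: continuous_comp => //; exact: (sH 0%N).
  exact: coord_continuous.
apply: cvg_trans Hc; apply: near_eq_cvg; near=> t.
by rewrite /=; near: t; apply: filterS HGm => t ->.
Unshelve. all: by end_near. Qed.

End body_manifolds.

Theorem proposition3p2 (R : realType) (k : nat) (F : body_manifold R k -> Prop)
    (p : R) (hp : 1 < p) :
  p_regular p ((fun M _ x du => Disd du `^ p) : energy_density F).
Proof.
have p0 : 0 < p by lra.
have kp0 := powR_ge0 (Num.sqrt k%:R : R) p.
have two0 : 0 < 2 `^ p :> R by exact: powR_gt0.
split.
- move=> M _; split=> [c B Sc Y mY|x A eps eps0].
    have mYp : measurable ((@powR R ^~ p) @^-1` Y).
      by rewrite -[X in measurable X]setTI; exact: measurable_powR.
    exact: (Disd_chart_measurable B Sc mYp).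
  have [d d0 dP] := powR_continuous_nneg p0 (Disd_ge0 A) eps0.
  exists d => // B BA; apply: dP; first exact: Disd_ge0.
  exact: le_lt_trans (Disd_lipschitz _ _) BA.
(* Adding 1 keeps the second constant positive when k = 0. *)
- exists (2 `^ p)^-1, (Num.sqrt k%:R `^ p + 1); split.
  + by rewrite invr_gt0.
  + lra.
  + move=> M _ x A; rewrite lerBlDr ler_pdivrMl//.
    have := powRD_le p0 (Disd_ge0 A) (sqrtr_ge0 k%:R).
    have := ge0_ler_powR (ltW p0) (normd_ge0 A)
      (addr_ge0 (Disd_ge0 A) (sqrtr_ge0 k%:R)) (normd_le A).
    nra.
- exists (2 `^ p * (1 + Num.sqrt k%:R `^ p)); first by rewrite mulr_gt0//; lra.
  move=> M _ x A.
  apply: (le_trans (ge0_ler_powR (ltW p0) (Disd_ge0 A)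
    (addr_ge0 (normd_ge0 A) (sqrtr_ge0 k%:R)) (Disd_le A))).
  apply: (le_trans (powRD_le p0 (normd_ge0 A) (sqrtr_ge0 k%:R))).
  rewrite -mulrA ler_pM2l//; have := powR_ge0 (normd A) p; nra.
- exists 1 => // M N _ _ x y L A _.
  have rootK (z : R) : 0 <= z -> (z `^ p) `^ p^-1 = z.
    by move=> z0; rewrite -powRrM mulfV ?gt_eqF// powRr1.
  rewrite !rootK ?Disd_ge0//; apply: (le_trans (Disd_comp L A)).
  rewrite mul1r ler_wpM2r ?lerDr//.
  have [e fe] := bm_frame x; have [f ff] := bm_frame y.
  rewrite /DisL (Dis_frame ((bm_metricP M).1 x) ((bm_metricP N).1 y) fe ff).
  exact: rotation_dist_ge0.
Qed.
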